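(* Let $S=\{x,y,z\}\subseteq\mathcal{H}$ be a set of cardinality $3$. Then $x,y,z$ are affinely independent if and only if $CC(S)\in\mathcal{H}$.
   Context: $\mathcal{H}$ is a real Hilbert space with norm $\|\cdot\|$. $\operatorname{aff}(S)$ denotes the affine hull of $S$. Vectors $x,y,z$ are affinely independent if $\operatorname{aff}\{x,y,z\}$ has dimension $2$ (equivalently, $y-x,z-x$ are linearly independent). Circumcenter: for a nonempty finite set $S\subseteq\mathcal{H}$ there is at most one point $p\in\mathcal{H}$ such that $p\in\operatorname{aff}(S)$ and $\{\|p-s\|\mid s\in S\}$ is a singleton. $CC(S)$ is defined to be this point $p$ if it exists, and $CC(S)=\varnothing$ otherwise; ''$CC(S)\in\mathcal{H}$'' means the point exists. *)

(* Defs.v *)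
From HB Require Import structures.
From mathcomp Require Import all_boot all_order all_algebra.
From mathcomp Require Import all_classical all_reals all_analysis.
From mathcomp Require Import ring lra.

Set Implicit Arguments.
Unset Strict Implicit.
Unset Printing Implicit Defensive.

Import Order.TTheory GRing.Theory Num.Theory.
Import numFieldNormedType.Exports.

Local Open Scope classical_set_scope.
Local Open Scope ring_scope.

Section AffineHull.
Context {R : realType} {E : lmodType R}.

(* The empty set also qualifies; this does not change the affine hull of a
   nonempty set. *)
Definition affine_subspace (A : set E) : Prop :=
  forall (t : R) (u v : E), A u -> A v -> A (t *: u + (1 - t) *: v).

Definition aff (S : set E) : set E := smallest affine_subspace S.

Definition linearly_independent (n : nat) (b : 'I_n -> E) : Prop :=
  forall c : 'I_n -> R, \sum_(i < n) c i *: b i = 0 -> forall i, c i = 0.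

(* [A] is a translate of an [n]-dimensional linear subspace, which is given by
   a basis [b]; [E] itself may be infinite-dimensional. *)
Definition has_affine_dim (A : set E) (n : nat) : Prop :=
  exists (a : E) (b : 'I_n -> E),
    linearly_independent b /\
    A = [set a + \sum_(i < n) c i *: b i | c in [set: 'I_n -> R]].

Definition affinely_independent3 (x y z : E) : Prop :=
  has_affine_dim (aff [set x; y; z]) 2.

End AffineHull.

Section Circumcenter.
Context {R : realType} {H : normedModType R}.

Definition is_circumcenter (S : set H) (p : H) : Prop :=
  aff S p /\ exists r : R, [set `|p - s| | s in S] = [set r].

(* [None] plays the role of the value $\varnothing$. In an inner product space
   the chosen point is the only one, by [is_circumcenter_unique]. *)
Definition CC (S : set H) : option H :=
  if pselect (exists p, is_circumcenter S p) is left h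
  then Some (projT1 (cid h)) else None.

Lemma CC_some (S : set H) (p : H) : CC S = Some p -> is_circumcenter S p.
Proof. by rewrite /CC; case: pselect => // h [<-]; case: cid. Qed.

Lemma CC_none (S : set H) : CC S = None <-> ~ exists p, is_circumcenter S p.
Proof. by rewrite /CC; case: pselect. Qed.

Lemma is_circumcenter_unique (dot : {dot H for idfun})
    (hdot : forall u, dot u u = `|u| ^+ 2) (S : set H) (p q : H) :
  is_circumcenter S p -> is_circumcenter S q -> p = q.
Proof.
move=> [Sp [r rP]] [Sq [r' r'P]].
have dotC u v : dot u v = dot v u by rewrite (hermC dot) expr0 mul1r.
have sqB u v : `|u - v| ^+ 2 = `|u| ^+ 2 - 2 * dot v u + `|v| ^+ 2.
  by rewrite -!hdot linearBr !linearBl /= [dot u v]dotC; ring.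
pose k := (`|p| ^+ 2 - `|q| ^+ 2 - r ^+ 2 + r' ^+ 2) / 2.
have hull s : aff S s -> dot s (p - q) = k.
  apply: (@smallest_sub _ _ S [set s | dot s (p - q) = k]).
  - by move=> t u v /= uk vk; rewrite linearDl !linearZl_LR /= uk vk; ring.
  - move=> u Su /=.
    have pu : `|p - u| = r by have : [set r] `|p - u| by rewrite -rP; exists u.
    have qu : `|q - u| = r'
      by have : [set r'] `|q - u| by rewrite -r'P; exists u.
    by rewrite /k -pu -qu !sqB linearBr /=; field.
apply/eqP; rewrite -subr_eq0 -normr_eq0 -sqrf_eq0 -hdot.
by rewrite [X in X == _]linearBl /= !hull // subrr.
Qed.

End Circumcenter.

(* Main.v *)
Require Import Defs.
From mathcomp Require Import all_boot all_order all_algebra.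
From mathcomp Require Import all_classical all_reals all_analysis.
From mathcomp Require Import ring lra.

Import Order.TTheory GRing.Theory Num.Theory.
Import numFieldNormedType.Exports.

Local Open Scope classical_set_scope.
Local Open Scope ring_scope.

(** Put [u = y - x] and [v = z - x]. The affine hull of [x, y, z] consists of
    the points [x + (a u + b v)], and it is two-dimensional exactly when [u] and
    [v] are linearly independent ([affinely_independent3P]). A point [x + w] is
    equidistant from [x], [y] and [z] exactly when [2 <w, u> = |u|^2] and
    [2 <w, v> = |v|^2] ([norm_eq_normB]), so a circumcenter is a
    solution [w = a u + b v] of this pair of linear equations, whose matrix is
    the Gram matrix of [u] and [v].

    If [u] and [v] are independent, the Gram determinant is nonzero
    ([gram_det_neq0]) and Cramer's rule gives the circumcenter. Conversely,
    pairing a relation [a u + b v = 0] with [w] forces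
    [a |u|^2 + b |v|^2 = 0]. Together with the pairings with [u] and [v], this
    makes [a = b = 0], provided that [u], [v] and [u - v] are nonzero, that is,
    provided that the three points are distinct: geometrically, a line meets a
    sphere in at most two points. *)

Section Combinations.
Context {R : realType} {E : lmodType R}.
Implicit Types (a b c d k t : R) (u v w x y z : E).

Lemma combD u v a b c d :
  (a *: u + b *: v) + (c *: u + d *: v) = (a + c) *: u + (b + d) *: v.
Proof. by rewrite addrACA -!scalerDl. Qed.

Lemma combZ u v k a b :
  k *: (a *: u + b *: v) = (k * a) *: u + (k * b) *: v.
Proof. by rewrite scalerDr !scalerA. Qed.

Lemma affine_comb_translate x u v t :
  t *: (x + u) + (1 - t) *: (x + v) = x + (t *: u + (1 - t) *: v).
Proof. by rewrite !scalerDr addrACA -scalerDl [t + _]addrC subrK scale1r. Qed.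

Lemma aff3P x y z w :
  aff [set x; y; z] w <->
  exists a b, w = x + (a *: (y - x) + b *: (z - x)).
Proof.
split.
  apply: (smallest_sub (X := [set w | exists a b,
    w = x + (a *: (y - x) + b *: (z - x))])).
    move=> t _ _ /= [a [b ->]] [c [d ->]].
    rewrite affine_comb_translate !combZ combD.
    by eexists; eexists.
  move=> _ /= [[->|->]|->].
  - by exists 0, 0; rewrite !scale0r !addr0.
  - by exists 1, 0; rewrite scale0r scale1r addr0 addrC subrK.
  - by exists 0, 1; rewrite scale0r scale1r add0r addrC subrK.
move=> [a [b ->]] A [affA sub].
have Ax : A x by apply: sub; left; left.
have Ay : A y by apply: sub; left; right.
have Az : A z by apply: sub; right.
have ray t u : A u -> A (x + t *: (u - x)).
  move=> Au; have := affA t _ _ Au Ax.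
  rewrite -[in X in A X -> _](subrK x u) -[in X in _ + X](addr0 x).
  by rewrite [u - x + x]addrC affine_comb_translate scaler0 addr0.
(* An affine subspace is only closed under binary combinations: the point is
   the midpoint of two points on the lines [xy] and [xz]. *)
have := affA 2^-1 _ _ (ray (2 * a) _ Ay) (ray (2 * b) _ Az).
rewrite affine_comb_translate !scalerA.
have -> : 2^-1 * (2 * a) = a by field.
by have -> : (1 - 2^-1) * (2 * b) = b by field.
Qed.

Lemma sum_comb2 (c : 'I_2 -> R) (b : 'I_2 -> E) :
  \sum_(i < 2) c i *: b i = c ord0 *: b ord0 + c ord_max *: b ord_max.
Proof.
rewrite big_ord_recr big_ord1 /=.
by congr (c _ *: b _ + _); apply: val_inj.
Qed.

(** From left to right this is invariance of dimension in rank two: a span that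
    contains two independent vectors has independent generators. *)
Lemma affinely_independent3P x y z :
  affinely_independent3 x y z <->
  forall a b, a *: (y - x) + b *: (z - x) = 0 -> a = 0 /\ b = 0.
Proof.
set u := y - x; set v := z - x; split.
  move=> [x0 [e [free_e affE]]] a b ab0.
  have free2 m n : m *: e ord0 + n *: e ord_max = 0 -> m = 0 /\ n = 0.
    move=> comb0.
    pose c (i : 'I_2) := if i == ord0 then m else n.
    have c0 : forall i, c i = 0 by apply: free_e; rewrite sum_comb2.
    by split; [exact: (c0 ord0)|exact: (c0 ord_max)].
  have span m n : exists s t, m *: e ord0 + n *: e ord_max = s *: u + t *: v.
    have in_aff p q : aff [set x; y; z] (x0 + (p *: e ord0 + q *: e ord_max)).
      rewrite affE; exists (fun i : 'I_2 => if i == ord0 then p else q) => //.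
      by rewrite sum_comb2.
    have /aff3P[s [t st]] := in_aff m n.
    have /aff3P[s' [t' st']] := in_aff 0 0.
    exists (s - s'), (t - t').
    rewrite !scale0r !addr0 in st'.
    rewrite -[LHS](addKr x0) st st' opprD addrACA addNr add0r.
    by rewrite addrC -[- (s' *: u + _)]scaleN1r combZ combD !mulN1r.
  have [s [t e0E]] := span 1 0.
  have [s' [t' e1E]] := span 0 1.
  rewrite scale0r scale1r addr0 in e0E.
  rewrite scale0r scale1r add0r in e1E.
  (* These coefficients make the combination of [e] proportional to
     [a u + b v]. *)
  have [] := free2 (t' * a - s' * b) (s * b - t * a).
    rewrite e0E e1E !combZ combD.
    transitivity ((s * t' - s' * t) *: (a *: u + b *: v)).
      by rewrite combZ; congr (_ *: _ + _ *: _); ring.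
    by rewrite ab0 scaler0.
  move=> _ /eqP; rewrite subr_eq0 => /eqP sbta.
  have [a0 _] : a = 0 /\ (0 : R) = 0.
    apply: free2; rewrite scale0r addr0 e0E combZ [a * t]mulrC -sbta.
    by rewrite [a * s]mulrC -combZ ab0 scaler0.
  have [b0 _] : b = 0 /\ (0 : R) = 0.
    apply: free2; rewrite scale0r addr0 e0E combZ [b * s]mulrC sbta.
    by rewrite [b * t]mulrC -combZ ab0 scaler0.
  by [].
move=> free_uv; exists x, (fun i : 'I_2 => if i == ord0 then u else v).
split.
  move=> c; rewrite sum_comb2 /= => /free_uv[c0 c1] i.
  by case: (unliftP ord_max i) => [j ->|-> //]; rewrite ord1 -c0; congr c;
    apply: val_inj.
apply/seteqP; split=> [w /aff3P[a [b ->]]|_ [c _ <-]].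
  exists (fun i : 'I_2 => if i == ord0 then a else b) => //.
  by rewrite sum_comb2.
by apply/aff3P; exists (c ord0), (c ord_max); rewrite sum_comb2.
Qed.

End Combinations.

Section InnerProduct.
Context {R : realType} {H : normedModType R} (dot : {dot H for idfun}).
Hypothesis dot_norm : forall u : H, dot u u = `|u| ^+ 2.
Implicit Types (u v w p x y z : H).

Lemma dotC u v : dot u v = dot v u.
Proof. by rewrite (hermC dot) expr0 mul1r. Qed.

Lemma dot_combl a b u v w : dot (a *: u + b *: v) w = a * dot u w + b * dot v w.
Proof. by rewrite linearDl !linearZl_LR. Qed.

Lemma dot_eq0 u : dot u u = 0 -> u = 0.
Proof. by move/eqP; rewrite dot_norm sqrf_eq0 normr_eq0 => /eqP. Qed.

Lemma dotBB u v : dot (u - v) (u - v) = dot u u - 2 * dot u v + dot v v.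
Proof. by rewrite linearBr !linearBl /= [dot v u]dotC; ring. Qed.

(** The perpendicular bisector of [0] and [u] is an affine hyperplane. *)
Lemma norm_eq_normB w u : `|w| = `|w - u| <-> 2 * dot w u = dot u u.
Proof.
have -> : (`|w| = `|w - u|) <-> (dot w w = dot (w - u) (w - u)).
  rewrite !dot_norm; split=> [->//|/eqP].
  by rewrite eqrXn2// => /eqP.
by rewrite dotBB; split; lra.
Qed.

Lemma gram_det_neq0 u v :
  (forall a b, a *: u + b *: v = 0 -> a = 0 /\ b = 0) ->
  dot u u * dot v v - dot u v ^+ 2 != 0.
Proof.
move=> free_uv; apply/eqP => det0.
(* Up to the factor [|v|^2], this vector is the component of [u] orthogonal
   to [v]; its squared norm is [|v|^2] times the determinant. *)
pose w := dot v v *: u + (- dot u v) *: v.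
have /free_uv[vv0 _] : w = 0.
  apply: dot_eq0; rewrite /w dot_combl ![dot _ (_ + _)]dotC !dot_combl.
  rewrite [dot v u]dotC.
  transitivity (dot v v * (dot u u * dot v v - dot u v ^+ 2)); first by ring.
  by rewrite det0 mulr0.
have [_ /eqP] : (0 : R) = 0 /\ (1 : R) = 0.
  by apply: free_uv; rewrite (dot_eq0 _ vv0) scale0r scaler0 addr0.
by rewrite oner_eq0.
Qed.

Lemma is_circumcenter3P x y z p :
  is_circumcenter [set x; y; z] p <->
  exists a b, let w := a *: (y - x) + b *: (z - x) in
    [/\ p = x + w, 2 * dot w (y - x) = dot (y - x) (y - x)
      & 2 * dot w (z - x) = dot (z - x) (z - x)].
Proof.
have dist w s : `|x + w - s| = `|w - (s - x)|.
  by congr `| _ |; rewrite opprB [x + w]addrC addrA addrAC.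
have dist0 w : `|x + w - x| = `|w| by rewrite dist subrr subr0.
split.
  move=> [/aff3P[a [b ->]] [r rP]]; exists a, b.
  set w := a *: _ + _.
  have eqr s : [set x; y; z] s -> `|x + w - s| = r.
    by move=> ?; have : [set r] `|x + w - s| by rewrite -rP; exists s.
  have eqx : `|w| = r by rewrite -dist0; apply: eqr; left; left.
  split=> //; apply/norm_eq_normB; rewrite eqx -dist; apply/esym/eqr.
  - by left; right.
  - by right.
move=> [a [b]]; set w := a *: _ + _.
move=> [-> /norm_eq_normB wy /norm_eq_normB wz].
split; first by apply/aff3P; exists a, b.
exists `|w|; apply/seteqP; split=> [_ /= [s sxyz <-]|_ ->].
  by case: sxyz => [[]|] ->; rewrite ?dist0// dist.
by exists x; [left; left|rewrite dist0].
Qed.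

(** The normal equations in the coordinates [a], [b] with respect to [u], [v]
    have the Gram matrix as their matrix; the witnesses come from Cramer's
    rule. *)
Lemma normal_equations_solvable u v :
  dot u u * dot v v - dot u v ^+ 2 != 0 ->
  exists a b, let w := a *: u + b *: v in
    2 * dot w u = dot u u /\ 2 * dot w v = dot v v.
Proof.
set D := _ - _ => D0.
exists (dot v v * (dot u u - dot u v) / (2 * D)),
       (dot u u * (dot v v - dot u v) / (2 * D)).
by rewrite /= !dot_combl [dot v u]dotC; split; rewrite /D; field.
Qed.

(** Pairing [a u + b v = 0] with [u], [v] and [w] shows that the four numbers
    [a |u|^2], [a <u, v>], [- b <u, v>] and [- b |v|^2] coincide. If [<u, v>]
    is zero they all vanish; otherwise [b = - a], and then
    [a |u - v|^2 = 0]. *)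
Lemma normal_equations_independent u v w a b :
  u != 0 -> v != 0 -> u != v ->
  2 * dot w u = dot u u -> 2 * dot w v = dot v v ->
  a *: u + b *: v = 0 -> a = 0 /\ b = 0.
Proof.
move=> u0 v0 uv wu wv ab0.
have pair s : a * dot u s + b * dot v s = 0.
  by rewrite -dot_combl ab0 linear0l.
have eu := pair u; have ev := pair v; rewrite [dot v u]dotC in eu.
have ew : a * dot u u + b * dot v v = 0.
  have := pair w; rewrite ![dot _ w]dotC -wu -wv => ew.
  by rewrite !(mulrCA _ 2) -mulrDr ew mulr0.
have pos s : s != 0 -> dot s s != 0 by move=> /eqP s0; apply/eqP => /dot_eq0.
have duv : dot u u - 2 * dot u v + dot v v != 0.
  by rewrite -dotBB pos// subr_eq0.
have mul0 (c d : R) : d != 0 -> c * d = 0 -> c = 0.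
  by move=> /negPf d0 /eqP; rewrite mulf_eq0 d0 orbF => /eqP.
have [g0|g0] := eqVneq (dot u v) 0.
  rewrite g0 mulr0 addr0 in eu; rewrite g0 mulr0 add0r in ev.
  by split; [exact: mul0 (pos _ u0) eu|exact: mul0 (pos _ v0) ev].
have ab : a + b = 0 by apply: (mul0 _ _ g0); lra.
have bE : b = - a by lra.
rewrite bE in eu ev ew *.
have a0 : a = 0 by apply: (mul0 _ _ duv); lra.
by rewrite a0 oppr0.
Qed.

End InnerProduct.

Lemma card_set2_le (T : Type) (a b : T) : ([set a; b] #<= `I_2)%card.
Proof.
have -> : [set a; b] = (fun n => if n == 0%N then a else b) @` `I_2.
  apply/seteqP; split=> [_ /= [->|->]|_ /= [n _ <-]].
  - by exists 0%N.
  - by exists 1%N.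
  - by case: eqP; [left|right].
exact: card_image_le.
Qed.

Lemma card_set3_distinct (T : Type) (x y z : T) :
  ([set x; y; z] #= `I_3)%card -> [/\ y <> x, z <> x & y <> z].
Proof.
move=> card3.
have no2 a b : [set x; y; z] <> [set a; b].
  move=> E2; suff: (`I_3 #<= `I_2)%card by rewrite card_le_II.
  by rewrite -(card_le_eql card3) E2 card_set2_le.
split=> e; subst.
- by apply: (no2 x z); rewrite setUid.
- by apply: (no2 x y); rewrite setUAC setUid.
- by apply: (no2 x z); rewrite -setUA setUid.
Qed.

Theorem theorem8p1 (R : realType) (H : completeNormedModType R)
    (dot : {dot H for idfun}) (hdot : forall u : H, dot u u = `|u| ^+ 2)
    (S : set H) (x y z : H) (hS : S = [set x; y; z]) (hcard : (S #= `I_3)%card) :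
  affinely_independent3 x y z <-> exists p : H, CC S = Some p.
Proof.
subst S; have [yx zx yz] := card_set3_distinct _ _ _ _ hcard.
split=> [/affinely_independent3P free_uv|[p /CC_some]].
  have [a [b [wu wv]]] :=
    normal_equations_solvable dot _ _ (gram_det_neq0 _ hdot _ _ free_uv).
  case CCE : (CC _) => [p|]; first by exists p.
  case/CC_none: CCE; eexists; apply/(is_circumcenter3P _ hdot).
  by exists a, b; split.
move=> /(is_circumcenter3P _ hdot)[c [d [_ wu wv]]].
apply/affinely_independent3P => a b.
apply: (normal_equations_independent _ hdot) wu wv.
- by rewrite subr_eq0; apply/eqP.
- by rewrite subr_eq0; apply/eqP.
- by rewrite (inj_eq (addIr _)); apply/eqP.
Qed.
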